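(* For $\varepsilon\ge0$ let $$V(\varepsilon)=\inf\{D_\varphi(\mu\|\nu):\mu,\nu\in\mathcal M^1,\ \mathrm{TV}(\mu,\nu)=\varepsilon\}\qquad(\inf\emptyset=+\infty).$$ Then for all $\varepsilon\ge0$, $$V(\varepsilon)=\operatorname{hgt}_{\psi^\star}^\star(\varepsilon/2),\qquad\text{where }\operatorname{hgt}_{\psi^\star}^\star(s)=\sup_{w\ge0}\{sw-\operatorname{hgt}_{\psi^\star}(w)\}.$$ In particular, if $\operatorname{hgt}_{\psi^\star}$ is differentiable (on $[0,\infty)$, one-sidedly at $0$), then $V\big(2\operatorname{hgt}_{\psi^\star}'(x)\big)=x\operatorname{hgt}_{\psi^\star}'(x)-\operatorname{hgt}_{\psi^\star}(x)$ for $x\ge0$.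
   Context: $(\Omega,\mathcal F)$ is a measurable space with $\{\emptyset,\Omega\}\subsetneq\mathcal F$; $\mathcal M^1$ is the set of probability measures on it. $\mathrm{TV}(\mu,\nu)=\sup\{|\int g\,d\mu-\int g\,d\nu|: g:\Omega\to[-1,1]\text{ measurable}\}$ (so it takes values in $[0,2]$). Standing assumptions on $\varphi$: $\varphi:\mathbb R\to[0,+\infty]$ is convex, lower semicontinuous, $\varphi(1)=0$, $\varphi(x)=+\infty$ for $x<0$, and $\operatorname{dom}\varphi$ contains a neighborhood of $1$. $\varphi'(\infty)=\lim_{x\to\infty}\varphi(x)/x$. Set $\psi(x)=\varphi(x+1)$, with convex conjugate $\psi^\star(y)=\sup_x\{xy-\psi(x)\}$. For probability measures $\mu,\nu$ with Lebesgue decomposition $\mu=\mu_c+\mu_s$ ($\mu_c\ll\nu$, $\mu_s\perp\nu$), $D_\varphi(\mu\|\nu)=\int\varphi(\frac{d\mu_c}{d\nu})d\nu+\mu_s(\Omega)\varphi'(\infty)$, with $0\cdot\infty=0$. Sublevel set volume: $\operatorname{sls}_{\psi^\star}(h)$ is the Lebesgue measure of $\{x\in\mathbb R:\psi^\star(x)\le h\}$ (a compact interval). Height-for-width function: $\operatorname{hgt}_{\psi^\star}(w)=\inf\{h:\operatorname{sls}_{\psi^\star}(h)\ge w\}$ for $w\ge0$, where $h$ ranges over $[0,+\infty]$. *)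

(* Defs.v *)
From HB Require Import structures.
From mathcomp Require Import all_boot all_order all_algebra.
From mathcomp Require Import all_classical all_reals all_analysis.
From mathcomp Require Import measurable_realfun.

Set Implicit Arguments.
Unset Strict Implicit.
Unset Printing Implicit Defensive.

Import Order.TTheory GRing.Theory Num.Theory.
Import numFieldNormedType.Exports.

Local Open Scope classical_set_scope.
Local Open Scope ring_scope.
Local Open Scope ereal_scope.
Local Open Scope charge_scope.

Section convex_analysis.
Context {R : realType}.
Implicit Types (f : R -> \bar R) (h : \bar R) (w s x y : R).

(* Used for functions that never take the value -oo; the library convention
   0 * +oo = 0 makes the endpoints t = 0 and t = 1 harmless. *)
Definition ereal_convex f : Prop :=
  forall x y (t : R), (0 <= t <= 1)%R ->
    f (t * x + (1 - t) * y)%R <= t%:E * f x + (1 - t)%:E * f y.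

Definition dom f : set R := [set x | f x < +oo].

Definition recession_slope f : \bar R :=
  lim ((f x * (x^-1)%:E) @[x --> +oo%R]).

Definition recentered f : R -> \bar R := fun x => f (x + 1)%R.

Definition convex_conjugate f : R -> \bar R :=
  fun y => ereal_sup [set (x * y)%:E - f x | x in [set: R]].

Definition sls f h : \bar R := lebesgue_measure [set x | f x <= h].

(* Total in w, with value 0 for w < 0. When f = convex_conjugate g with
   g 0 = 0, 0 <= g and g = +oo on ]-oo, -1[, one has f y <= - y for y <= 0,
   hence sls f h >= h and hgt f w is finite. *)
Definition hgt f w : \bar R :=
  ereal_inf [set h | 0 <= h /\ w%:E <= sls f h].

(* Conjugate of a function of w >= 0: the supremum runs over [0, +oo[ only. *)
Definition conjugate_nonneg f s : \bar R :=
  ereal_sup [set (s * w)%:E - f w | w in [set w | (0 <= w)%R]].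

(* [g] is differentiable on [0, +oo[, one-sidedly at 0, with derivative [g']. *)
Definition derivative_on_nonneg (g g' : R -> R) : Prop :=
  (forall x, (0 < x)%R -> is_derive x (1%R : R) g (g' x)) /\
  ((h^-1 * (g h - g 0))%R @[h --> (0 : R)^'+] --> g' 0%R).

End convex_analysis.

Section lebesgue_decomposition.
Context d (T : measurableType d) (R : realType).

Definition mutually_singular (mu nu : {measure set T -> \bar R}) : Prop :=
  exists A : set T, [/\ measurable A, mu A = 0 & nu (~` A) = 0].

Definition is_lebesgue_decomposition (mu nu : {measure set T -> \bar R})
    (p : {finite_measure set T -> \bar R} * {finite_measure set T -> \bar R})
    : Prop :=
  [/\ forall A, measurable A -> mu A = p.1 A + p.2 A,
      p.1 `<< nu & mutually_singular p.2 nu].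

Lemma lebesgue_decomposition_exists (mu nu : {finite_measure set T -> \bar R}) :
  exists p, is_lebesgue_decomposition mu nu p.
Proof.
pose m2 n : {measure set T -> \bar R} := if n is 0%N then mu else nu.
have m2E A : msum m2 2 A = mu A + nu A by exact: measure_addE.
have m2_fin : fin_num_fun (msum m2 2).
  by move=> A mA; rewrite m2E fin_numD !fin_num_measure.
pose lam : {finite_measure set T -> \bar R} :=
  HB.pack (msum m2 2) (@Measure_isFinite.Build _ T R (msum m2 2) m2_fin).
have nulam : nu `<< lam.
  apply/null_content_dominatesP => A mA /=; rewrite m2E => A0.
  by apply/eqP; rewrite -measure_le0 -A0 leeDr// measure_ge0.
pose g := Radon_Nikodym_SigmaFinite.f nu lam.
have g0 : forall x, 0 <= g x by exact: Radon_Nikodym_SigmaFinite.f_ge0.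
have /integrableP[] := Radon_Nikodym_SigmaFinite.f_integrable nulam.
rewrite -/g => mg _.
have nuE A : measurable A -> nu A = \int[lam]_(x in A) g x.
  exact: Radon_Nikodym_SigmaFinite.f_integral.
pose N := [set x | g x = 0].
have mN : measurable N.
  by rewrite -[N]setTI; exact: (mg measurableT [set 0]).
have mNC : measurable (~` N) by exact: measurableC.
exists (mrestr mu mNC : {finite_measure set T -> \bar R},
        mrestr mu mN : {finite_measure set T -> \bar R}).
split => /=.
- move=> A mA; rewrite /mrestr -measureU; last 1 first.
  + by rewrite setIACA setICl setI0.
  + by rewrite -setIUr setvU setIT.
  + exact: measurableI.
  + exact: measurableI.
- apply/null_content_dominatesP => A mA A0; rewrite /mrestr.
  have : \int[lam]_(x in A) `|g x| = 0.
    by under eq_integral do rewrite gee0_abs//; rewrite -nuE.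
  have mgA : measurable_fun A g by exact: measurable_funS mg.
  move/(ae_eq_integral_abs _ mA mgA) => [B [mB B0 AB]].
  apply/eqP; rewrite -measure_le0.
  apply: (@le_trans _ _ (mu B)).
    apply: le_measure; rewrite ?inE//; first exact: measurableI.
    by move=> x [Ax gx]; apply: AB => /= /(_ Ax).
  by rewrite -B0 /= m2E leeDl// measure_ge0.
- exists (~` N); split; first exact: mNC.
    by rewrite /= /mrestr setICl measure0.
  rewrite setCK; transitivity (\int[lam]_(x in N) g x); first exact: nuE.
  by apply: integral0_eq => x.
Qed.

(* The decomposition is unique (on measurable sets), so the choice made by [cid]
   is immaterial. *)
Definition lebesgue_decomposition (mu nu : {finite_measure set T -> \bar R}) :=
  sval (cid (lebesgue_decomposition_exists mu nu)).

Definition ac_part (mu nu : {finite_measure set T -> \bar R}) :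
  {finite_measure set T -> \bar R} := (lebesgue_decomposition mu nu).1.

Definition singular_part (mu nu : {finite_measure set T -> \bar R}) :
  {finite_measure set T -> \bar R} := (lebesgue_decomposition mu nu).2.

End lebesgue_decomposition.

Section divergences.
Context d (T : measurableType d) (R : realType).
Implicit Types mu nu : probability T R.

Definition TV mu nu : \bar R :=
  ereal_sup [set `| \int[mu]_x (g x)%:E - \int[nu]_x (g x)%:E | | g in
    [set g : T -> R | measurable_fun [set: T] g /\
                      forall x, (-1 <= g x <= 1)%R]].

(* The Radon-Nikodym derivative of the library is \bar R-valued but everywhere
   finite, so [fine] loses nothing. *)
Definition phi_divergence (phi : R -> \bar R) mu nu : \bar R :=
  \int[nu]_x phi (fine ('d (charge_of_finite_measure (ac_part mu nu)) '/d nu x))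
  + singular_part mu nu [set: T] * recession_slope phi.

Definition divergence_at_TV (phi : R -> \bar R) (e : R) : \bar R :=
  ereal_inf [set v | exists mu nu, TV mu nu = e%:E /\
                                   v = phi_divergence phi mu nu].

End divergences.

(* Main.v *)
Require Import Defs.
From HB Require Import structures.
From mathcomp Require Import all_boot all_order all_algebra.
From mathcomp Require Import all_classical all_reals all_analysis.
From mathcomp Require Import measurable_realfun.
From mathcomp Require Import ring lra.

Set Implicit Arguments.
Unset Strict Implicit.
Unset Printing Implicit Defensive.

Import Order.TTheory GRing.Theory Num.Theory.
Import numFieldNormedType.Exports.

Local Open Scope classical_set_scope.
Local Open Scope ring_scope.
Local Open Scope ereal_scope.

(**
Both inequalities rest on Fenchel-Young. If psi^* <= h at the two points a <= b,
then psi^* <= h on [a, b], so phi x >= c (x - 1) - h for every c in [a, b]; taking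
c = g x with g valued in [a, b] and integrating gives
D(mu||nu) >= (b - a) TV(mu, nu) / 2 - h, and the best choice of a, b, h is hgt^*.

For the converse it is enough to use two-point measures: nu puts mass p on a point
and mu puts p + s there, with cost p phi(1 + s/p) + (1 - p) phi(1 - s/(1 - p)).
Writing each term as a biconjugate turns the infimum over p into an inf-sup over
p in [0, 1] and pairs (a, b) of a function affine in p; a one-dimensional minimax
argument exchanges the two, and the resulting sup-inf is hgt^*(s).
*)

(** * Conjugates of convex functions *)

Section convex_duality.
Context {R : realType}.
Implicit Types (f : R -> \bar R) (a b c e h m r s t w x y z : R).

(** Fenchel-Young without subtraction of extended reals: an infinite [f x] makes both pointwise
    inequalities true ([+oo]) or both false ([-oo]). *)
Lemma conjugate_leP f y h :
  convex_conjugate f y <= h%:E <-> forall x, (x * y - h)%:E <= f x.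
Proof.
have E x : ((x * y)%:E - f x <= h%:E) = ((x * y - h)%:E <= f x).
  case: (f x) => [r| |] /=; last by rewrite !leNgt ltry ltNyr.
    by rewrite -EFinB !lee_fin lerBlDr lerBlDl.
  by rewrite leNye leey.
split=> [fyh x|fyh]; last by apply: ge_ereal_sup => _ [x _ <-]; rewrite E.
by rewrite -E; apply: le_trans fyh; apply: ereal_sup_ubound; exists x.
Qed.

Lemma convex_le f x y r s t : ereal_convex f -> (0 <= t <= 1)%R ->
  f x <= r%:E -> f y <= s%:E ->
  f (t * x + (1 - t) * y)%R <= (t * r + (1 - t) * s)%:E.
Proof.
move=> cf t01 fx fy; apply: le_trans (cf x y t t01) _.
case/andP: t01 => t0 t1; rewrite [leRHS]EFinD !EFinM.
by apply: leeD; apply: lee_wpmul2l => //; rewrite lee_fin ?subr_ge0.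
Qed.

Lemma lower_semicontinuous_ball f x m : lower_semicontinuous f ->
  m%:E < f x -> exists2 e, (0 < e)%R & forall z, (`|x - z| < e)%R -> m%:E < f z.
Proof.
move=> lf /lf[V /nbhs_ballP[e /= e0 eV] Vf].
by exists e => // z xz; apply/Vf/eV.
Qed.

(* The slope is the supremum of the slopes of the chords that join points of the
   epigraph on the left of x to (x, m); semicontinuity makes it finite. *)
Lemma affine_minorant_left f x z0 e m : ereal_convex f -> (forall z, 0 <= f z) ->
  (0 < e)%R -> (forall z, (`|x - z| < e)%R -> m%:E < f z) ->
  (z0 < x)%R -> f z0 < +oo ->
  exists y, forall z, (m + y * (z - x))%:E <= f z.
Proof.
move=> cf f0 e0 fe z0x fz0.
pose S := [set s | exists z r, [/\ (z < x)%R, f z <= r%:E & s = ((m - r) / (x - z))%R]].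
have S0 : S !=set0.
  exists ((m - fine (f z0)) / (x - z0))%R; exists z0, (fine (f z0)); split => //.
  by rewrite fineK// ge0_fin_numE.
(* Within distance [e] of [x] the numerator is negative, since [m < f z <= r]; farther away,
   [r >= 0] bounds the quotient by [|m| / e]. *)
have Sub : ubound S (`|m| / e)%R.
  move=> _ [z [r [zx fzr ->]]]; have xz : (0 < x - z)%R by rewrite subr_gt0.
  have r0 : (0 <= r)%R by rewrite -lee_fin (le_trans _ fzr).
  rewrite ler_pdivrMr//; have [ez|ze] := leP e (x - z)%R; last first.
    have : m%:E < f z by apply: fe; rewrite gtr0_norm.
    move=> /lt_le_trans/(_ fzr); rewrite lte_fin => mr.
    by apply: (@le_trans _ _ 0%R); [lra|rewrite mulr_ge0// ?divr_ge0// ltW].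
  apply: (@le_trans _ _ `|m|%R); first by have := ler_norm m; lra.
  by rewrite -mulrA ler_peMr// mulrC ler_pdivlMr// mul1r.
have supS z r : (z < x)%R -> f z <= r%:E -> ((m - r) / (x - z) <= sup S)%R.
  by move=> zx fzr; apply: ub_le_sup; [exists (`|m| / e)%R|exists z, r].
have mx : m%:E < f x by apply: fe; rewrite subrr normr0.
exists (sup S) => z.
case E : (f z) => [r| |]; [|exact: leey|by have := f0 z; rewrite E].
have fzr : f z <= r%:E by rewrite E.
rewrite lee_fin; have [zx|xz|zx] := ltgtP z x.
- have := supS _ _ zx fzr; rewrite ler_pdivrMr ?subr_gt0//; lra.
- have zx0 : (0 < z - x)%R by rewrite subr_gt0.
  (* On the right of [x], every chord from [(u, q)] to [(z, r)] with [u < x] passes above [(x, m)],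
     which compares the slopes on its two sides. *)
  suff : (sup S <= (r - m) / (z - x))%R by rewrite ler_pdivlMr//; lra.
  apply: ge_sup => // _ [u [q [ux fuq ->]]].
  have xu : (0 < x - u)%R by rewrite subr_gt0.
  have zu : (0 < z - u)%R by lra.
  pose t := ((z - x) / (z - u))%R.
  have t1 : (1 - t = (x - u) / (z - u))%R.
    by rewrite /t; field; rewrite gt_eqF.
  have t01 : (0 <= t <= 1)%R.
    by rewrite -[(t <= 1)%R]subr_ge0 t1 /t !divr_ge0// ltW.
  have xE : (t * u + (1 - t) * z)%R = x by rewrite t1 /t; field; rewrite gt_eqF.
  have := convex_le cf t01 fuq fzr.
  rewrite xE => /(lt_le_trans mx); rewrite lte_fin t1 /t => mlt.
  rewrite ler_pdivrMr// [leRHS]mulrAC ler_pdivlMr//.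
  have : (m * (z - u) < (z - x) * q + (x - u) * r)%R.
    rewrite -ltr_pdivlMr//; apply: lt_le_trans mlt _.
    by rewrite le_eqVlt; apply/orP; left; apply/eqP; field; rewrite gt_eqF.
  nra.
- by rewrite -lee_fin -E zx subrr mulr0 addr0; exact: ltW.
Qed.

(** Mirror image of the left-hand case under [z |-> - z]. *)
Lemma affine_minorant_right f x z0 e m : ereal_convex f -> (forall z, 0 <= f z) ->
  (0 < e)%R -> (forall z, (`|x - z| < e)%R -> m%:E < f z) ->
  (x < z0)%R -> f z0 < +oo ->
  exists y, forall z, (m + y * (z - x))%:E <= f z.
Proof.
move=> cf f0 e0 fe xz0 fz0.
have cg : ereal_convex (f \o -%R).
  by move=> u v t t01 /=; rewrite opprD -!mulrN; exact: cf.
have ge z : (`|- x - z| < e)%R -> m%:E < (f \o -%R) z.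
  by rewrite -opprD normrN => xz; apply: fe; rewrite opprK.
have g0 z : 0 <= (f \o -%R) z by exact: f0.
have nz0 : (- z0 < - x)%R by rewrite ltrN2.
have gz0 : (f \o -%R) (- z0)%R < +oo by rewrite /= opprK.
have [y yf] := affine_minorant_left cg g0 e0 ge nz0 gz0.
exists (- y)%R => z; have := yf (- z)%R; rewrite /= !opprK.
by apply: le_trans; rewrite lee_fin; lra.
Qed.

Lemma conjugate_ge0 f y : f 0%R = 0 -> 0 <= convex_conjugate f y.
Proof.
move=> f0; apply: ereal_sup_ubound; exists 0%R => //.
by rewrite f0 mul0r sube0.
Qed.

(* The nontrivial half of f = f** *)
Lemma biconjugate_le f x m : ereal_convex f -> (forall z, 0 <= f z) ->
  lower_semicontinuous f -> f 0%R = 0 ->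
  (forall y h, convex_conjugate f y <= h%:E -> (x * y - h <= m)%R) ->
  f x <= m%:E.
Proof.
move=> cf f0 lf f00 H; rewrite leNgt; apply/negP => mx.
(* A level strictly between [m] and [f x]: an affine minorant with value [m'] at [x] yields
   [x * y - h = m' > m], against the hypothesis. *)
have [m' mm' m'x] : exists2 m', (m < m')%R & m'%:E < f x.
  case E : (f x) mx => [r| |] // mx.
    by exists ((m + r) / 2)%R; rewrite ?lte_fin in mx *; rewrite ?midf_lt.
  by exists (m + 1)%R; rewrite ?ltry ?ltrDl.
have [e e0 fe] := lower_semicontinuous_ball lf m'x.
suff [y yf] : exists y, forall z, (m' + y * (z - x))%:E <= f z.
  have : convex_conjugate f y <= (x * y - m')%:E.
    by apply/conjugate_leP => z; apply: le_trans (yf z); rewrite lee_fin; lra.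
  by move/H; lra.
have f0y : f 0%R < +oo by rewrite f00 ltry.
have [x0|x0|x0] := ltgtP x 0%R.
- by exact: (affine_minorant_right cf f0 e0 fe x0 f0y).
- by exact: (affine_minorant_left cf f0 e0 fe x0 f0y).
(* Here the origin lies on neither side of [x]; the zero slope gives [0 <= m], while
   [m < m' < f 0 = 0]. *)
- have : (x * 0 - 0 <= m)%R by apply: H; apply/conjugate_leP => z; rewrite mulr0 subrr.
  rewrite x0 f00 lte_fin in m'x; lra.
Qed.

Lemma conjugate_convex f a b r s t : (0 <= t <= 1)%R ->
  convex_conjugate f a <= r%:E -> convex_conjugate f b <= s%:E ->
  convex_conjugate f (t * a + (1 - t) * b)%R <= (t * r + (1 - t) * s)%:E.
Proof.
move=> /andP[t0 t1] /conjugate_leP fa /conjugate_leP fb.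
apply/conjugate_leP => x; move: (fa x) (fb x).
case: (f x) => [q| |] //; last by move=> _ _; exact: leey.
rewrite !lee_fin => xa xb; nra.
Qed.

(** Follows from convexity of the conjugate; being intervals, the sublevel sets are measurable
    whatever [f] is. *)
Lemma sublevel_conjugate_itv f h :
  is_interval [set y | convex_conjugate f y <= h%:E].
Proof.
move=> a b /= fa fb z /andP[az zb].
have [ab|ab] := eqVneq a b.
  by have -> : z = a by apply/eqP; rewrite eq_le az ab zb.
have ab0 : (0 < b - a)%R by rewrite subr_gt0 lt_neqAle ab (le_trans az).
pose t := ((b - z) / (b - a))%R.
have t1 : (1 - t = (z - a) / (b - a))%R by rewrite /t; field; rewrite gt_eqF.
have t01 : (0 <= t <= 1)%R.
  by rewrite -[(t <= 1)%R]subr_ge0 t1 /t !divr_ge0 ?subr_ge0// ltW// -subr_gt0.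
have := conjugate_convex t01 fa fb.
have -> : (t * a + (1 - t) * b)%R = z.
  by rewrite t1 /t; field; rewrite gt_eqF.
by have -> : (t * h + (1 - t) * h = h)%R by ring.
Qed.

Lemma sls_conjugate_ge f a b h : convex_conjugate f a <= h%:E ->
  convex_conjugate f b <= h%:E -> (b - a)%:E <= sls (convex_conjugate f) h%:E.
Proof.
move=> fa fb; have [ab|ba] := ltP a b; last first.
  by apply: le_trans (measure_ge0 _ _); rewrite lee_fin subr_le0.
have -> : (b - a)%:E = lebesgue_measure `[a, b]%classic.
  by rewrite lebesgue_measure_itv/= lte_fin ab EFinB.
apply: le_measure; rewrite ?inE//.
  by apply: is_interval_measurable; exact: sublevel_conjugate_itv.
move=> z /=; rewrite in_itv/= => azb.
exact: (sublevel_conjugate_itv fa fb).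
Qed.

(** Otherwise the sublevel set lies in [[inf S, sup S]], of length at most [v < w]. The slack
    between [v] and [w] avoids asking whether the endpoints are attained. *)
Lemma sls_gt_pair (g : R -> \bar R) h v w : (0 <= v < w)%R -> w%:E <= sls g h%:E ->
  exists a b, [/\ g a <= h%:E, g b <= h%:E & (v <= b - a)%R].
Proof.
move=> /andP[v0 vw] wS; apply: contrapT => nab.
pose S := [set x | g x <= h%:E].
have Sv a b : S a -> S b -> (b - a <= v)%R.
  by move=> Sa Sb; rewrite leNgt; apply/negP => /ltW vab; apply: nab; exists a, b.
have [/set0P[x0 Sx0]|/negPn/eqP S0] := boolP (S != set0); last first.
  by move: wS; rewrite /sls -/S S0 measure0 lee_fin; lra.
have supS : has_ubound S by exists (v + x0)%R => b Sb; have := Sv _ _ Sx0 Sb; lra.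
have infS : has_lbound S by exists (x0 - v)%R => a Sa; have := Sv _ _ Sa Sx0; lra.
have SI : (sup S - inf S <= v)%R.
  rewrite lerBlDr -lerBlDl; apply: lb_le_inf; first by exists x0.
  move=> a Sa; rewrite lerBlDl; apply: ge_sup; first by exists x0.
  by move=> b Sb; have := Sv _ _ Sa Sb; lra.
suff : sls g h%:E <= v%:E by move/(le_trans wS); rewrite lee_fin; lra.
have IS : (inf S <= sup S)%R.
  by apply: (@le_trans _ _ x0); [exact: ge_inf|exact: ub_le_sup].
apply: (@le_trans _ _ (lebesgue_measure `[inf S, sup S]%classic)).
  (* The sublevel set of an arbitrary [g] need not be measurable, hence monotonicity of the outer
     measure. *)
  apply: (@le_outer_measure _ _ (mu_ext (wlength idfun))) => x Sx /=.
  rewrite in_itv/=; apply/andP; split.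
    exact: ge_inf.
  exact: ub_le_sup.
by rewrite lebesgue_measure_itv/= lte_fin; case: ifP => // _; rewrite -EFinB lee_fin.
Qed.

End convex_duality.

(** * Minimax in one variable *)

Section common_weight.
Context {R : realType}.
Implicit Types (c m p r s t u v : R).

(* Each triple (c, r, s) confines p to a closed subinterval of [0, 1]; these
   intervals meet pairwise by convexity, hence have a common point (Helly). *)
Lemma common_weight (P : R -> R -> R -> Prop) m :
  (forall c r s c' r' s' t, (0 <= t <= 1)%R -> P c r s -> P c' r' s' ->
    P (t * c + (1 - t) * c')%R (t * r + (1 - t) * r')%R (t * s + (1 - t) * s')%R) ->
  (forall c r s, P c r s -> c <= m + Num.max r s)%R ->
  exists2 p, (0 <= p <= 1)%R &
    forall c r s, P c r s -> (c <= m + p * r + (1 - p) * s)%R.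
Proof.
move=> Pconv Pmax.
(* Lower bounds on [p]: when [s < r], the constraint reads [(c - s - m) / (r - s) <= p]. The element
   0 makes [L] nonempty and [sup L] nonnegative. *)
pose L := [set x | x = 0%R \/ exists c r s,
  [/\ P c r s, (s < r)%R & x = ((c - s - m) / (r - s))%R]].
have L1 : ubound L 1%R.
  move=> _ [->|[c [r [s [Pc sr ->]]]]]; first exact: ler01.
  rewrite ler_pdivrMr ?subr_gt0// mul1r.
  by have := Pmax _ _ _ Pc; rewrite (max_l (ltW sr)); lra.
have Lsup : has_ubound L by exists 1%R.
have L0 : L 0%R by left.
exists (sup L).
  by rewrite ub_le_sup//= ge_sup//; exists 0%R.
move=> c r s Pc; have [sr|rs|rs] := ltgtP s r; last first.
- by have := Pmax _ _ _ Pc; rewrite rs maxxx; lra.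
- suff : (sup L <= (s + m - c) / (s - r))%R by rewrite ler_pdivlMr ?subr_gt0//; lra.
  have sr0 : (0 < s - r)%R by rewrite subr_gt0.
  apply: ge_sup; first by exists 0%R.
  move=> _ [->|[c' [r' [s' [Pc' sr' ->]]]]].
    apply: divr_ge0; last exact: ltW.
    by have := Pmax _ _ _ Pc; rewrite (max_r (ltW rs)); lra.
  have rs0 : (0 < r' - s')%R by rewrite subr_gt0.
  have D0 : (0 < (s - r) + (r' - s'))%R by exact: addr_gt0.
  have D0' : (s - r + (r' - s') != 0)%R by rewrite gt_eqF.
  (* This weight equalizes the combined [r] and [s] coordinates, so that [Num.max] disappears from
     the hypothesis. *)
  pose t := ((r' - s') / ((s - r) + (r' - s')))%R.
  have t1 : (1 - t = (s - r) / ((s - r) + (r' - s')))%R by rewrite /t; field.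
  have t01 : (0 <= t <= 1)%R.
    by rewrite -[(t <= 1)%R]subr_ge0 t1 /t !divr_ge0// ltW.
  have := Pmax _ _ _ (Pconv _ _ _ _ _ _ _ t01 Pc Pc').
  have -> : (t * s + (1 - t) * s' = t * r + (1 - t) * r')%R.
    by rewrite t1 /t; field.
  rewrite maxxx => H.
  rewrite ler_pdivrMr// mulrAC ler_pdivlMr//.
  have {H} : (((r' - s') * c + (s - r) * c') / ((s - r) + (r' - s'))
      <= m + ((r' - s') * r + (s - r) * r') / ((s - r) + (r' - s')))%R.
    move: H; rewrite t1 /t; congr (_ <= _)%R; [by field|by field].
  rewrite ler_pdivrMr// [leRHS]mulrDl divfK//; lra.
- have rs0 : (0 < r - s)%R by rewrite subr_gt0.
  have : ((c - s - m) / (r - s) <= sup L)%R.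
    by apply: ub_le_sup => //; right; exists c, r, s.
  rewrite ler_pdivrMr//; lra.
Qed.

End common_weight.

(** * Recession slope and height-for-width function *)

Section recession_slope.
Context {R : realType}.
Variable phi : R -> \bar R.
Hypothesis phi_ge0 : forall x, 0 <= phi x.
Hypothesis phi_convex : ereal_convex phi.
Hypothesis phi1 : phi 1%R = 0.
Implicit Types (b h k l m t x z : R).

(** Slopes of the chords from [(1, 0)] to the points of the graph of [phi] on its right. *)
Let chord_slopes :=
  [set recentered phi x * (x^-1)%:E | x in [set x : R | (0 < x)%R]].

(* phi x / x need not be monotone in x, but phi (1 + x) / x is. *)
Lemma recession_slope_near l m : l%:E < m%:E -> m%:E < ereal_sup chord_slopes ->
  \forall x \near +oo%R, l%:E <= phi x * (x^-1)%:E.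
Proof.
rewrite lte_fin => lm /ereal_sup_gt[_ [x0 /= x00 <-]] mx0.
near=> z.
have z1 : (x0 + 1 <= z)%R by near: z; apply: nbhs_pinfty_ge; rewrite num_real.
(* Equivalent to [l * z <= m * (z - 1)], which absorbs the shift by 1. *)
have zm : (m / (m - l) <= z)%R.
  by near: z; apply: nbhs_pinfty_ge; rewrite num_real.
have z0 : (0 < z)%R by lra.
rewrite lee_pdivlMr//.
case E : (phi z) => [r| |]; [|exact: leey|by have := phi_ge0 z; rewrite E].
have zz : (0 < z - 1)%R by lra.
pose t := (x0 / (z - 1))%R.
have t01 : (0 <= t <= 1)%R.
  by rewrite divr_ge0 ?(ltW x00) ?(ltW zz)//= ler_pdivrMr// mul1r; lra.
have phir : phi z <= r%:E by rewrite E.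
have phi0 : phi 1%R <= 0%:E by rewrite phi1.
have := convex_le phi_convex t01 phir phi0.
have -> : (t * z + (1 - t) * 1 = x0 + 1)%R by rewrite /t; field; rewrite gt_eqF.
rewrite mulr0 addr0 => tr; move: mx0; rewrite lte_pdivlMr// => /lt_le_trans/(_ tr).
rewrite -EFinM !lte_fin lee_fin /t mulrAC ltr_pdivlMr//.
have -> : (m * x0 * (z - 1) = x0 * (m * (z - 1)))%R by ring.
rewrite ltr_pM2l// => /ltW; apply: le_trans.
move: zm; rewrite ler_pdivrMr ?subr_gt0//; lra.
Unshelve. all: by end_near. Qed.

Lemma recession_slope_ge0 : 0 <= ereal_sup chord_slopes.
Proof.
apply: (@le_trans _ _ (recentered phi 1%R * (1^-1)%:E)).
  by rewrite mule_ge0// ?lee_fin ?invr_ge0// phi_ge0.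
by apply: ereal_sup_ubound; exists 1%R => //=; exact: ltr01.
Qed.

(** Squeeze: [phi z / z] is at most the chord slope [phi z / (z - 1)], and [recession_slope_near]
    bounds it from below. The limit therefore exists and [lim] is not a default value. *)
Lemma recession_slopeE : recession_slope phi = ereal_sup chord_slopes.
Proof.
have leS : \forall x \near +oo%R, phi x * (x^-1)%:E <= ereal_sup chord_slopes.
  near=> z.
  have z1 : (2 <= z)%R by near: z; apply: nbhs_pinfty_ge; rewrite num_real.
  apply: (@le_trans _ _ (phi z * ((z - 1)^-1)%:E)).
    by apply: lee_wpmul2l => //; rewrite lee_fin lef_pV2 ?posrE; lra.
  apply: ereal_sup_ubound; exists (z - 1)%R; first by rewrite /=; lra.
  by rewrite /recentered subrK.
apply: cvg_lim; first exact: ereal_hausdorff.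
case E : (ereal_sup chord_slopes) => [s| |].
- apply/fine_cvgP; split.
    near=> z.
    have z1 : (2 <= z)%R by near: z; apply: nbhs_pinfty_ge; rewrite num_real.
    have zS : phi z * (z^-1)%:E <= ereal_sup chord_slopes by near: z.
    rewrite ge0_fin_numE; first by rewrite (le_lt_trans zS)// E ltry.
    by rewrite mule_ge0// lee_fin invr_ge0; lra.
  apply/cvgrPdist_le => /= e e0; near=> z.
  have zS : phi z * (z^-1)%:E <= ereal_sup chord_slopes by near: z.
  have Sz : (s - e)%:E <= phi z * (z^-1)%:E.
    near: z; apply: (@recession_slope_near _ (s - e / 2)%R).
      by rewrite lte_fin; lra.
    by rewrite E lte_fin; lra.
  move: zS Sz; rewrite E /=; case: (phi z * _) => [r| |] //.
  rewrite !lee_fin => rs sr. by rewrite ler_norml; apply/andP; split; rewrite /=; lra.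
- apply/cvgeyPge => A; apply: (@recession_slope_near _ (A + 1)%R).
    by rewrite lte_fin; lra.
  by rewrite E ltry.
- by have := recession_slope_ge0; rewrite E.
Unshelve. all: by end_near. Qed.

(** With [s] the slope, Fenchel-Young gives [x * b - h <= x * s] for all [x > 0], which fails for
    large [x] if [s < b]. This controls the singular part of [mu]. *)
Lemma conjugate_dom_le_recession_slope b h :
  convex_conjugate (recentered phi) b <= h%:E -> b%:E <= recession_slope phi.
Proof.
move=> /conjugate_leP bh; rewrite recession_slopeE.
case E : (ereal_sup chord_slopes) => [s| |]; last 2 first.
- exact: leey.
- by have := recession_slope_ge0; rewrite E.
rewrite lee_fin leNgt; apply/negP => sb.
have bs : (0 < b - s)%R by rewrite subr_gt0.
pose x := ((`|h| + 1) / (b - s))%R.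
have x0 : (0 < x)%R by apply: divr_gt0 => //; have := normr_ge0 h; lra.
have : recentered phi x * (x^-1)%:E <= s%:E.
  by rewrite -E; apply: ereal_sup_ubound; exists x.
rewrite lee_pdivrMr// -EFinM => /(le_trans (bh x)); rewrite lee_fin.
have : (x * (b - s) = `|h| + 1)%R by rewrite divfK// gt_eqF.
have := ler_norm h; lra.
Qed.

Lemma recession_slope_le k : (forall x, (0 < x)%R -> recentered phi x <= (x * k)%:E) ->
  recession_slope phi <= k%:E.
Proof.
move=> H; rewrite recession_slopeE; apply: ge_ereal_sup => _ [x /= x0 <-].
by rewrite lee_pdivrMr// -EFinM mulrC; exact: H.
Qed.

End recession_slope.

Section height_for_width.
Context {R : realType}.
Variable f : R -> \bar R.
Implicit Types (a b h k t v w x y s : R).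

Let H := hgt (convex_conjugate f).

Lemma hgt_ge0 w : 0 <= H w.
Proof. by apply: le_ereal_inf_tmp => h [h0 _]. Qed.

Lemma hgt_le w h : (0 <= h)%R -> w%:E <= sls (convex_conjugate f) h%:E -> H w <= h%:E.
Proof. by move=> h0 wh; apply: ge_ereal_inf; exists h%:E. Qed.

Lemma hgt_pair_le a b h : f 0%R = 0 -> convex_conjugate f a <= h%:E ->
  convex_conjugate f b <= h%:E -> H (b - a)%R <= h%:E.
Proof.
move=> f0 fa fb; apply: hgt_le; last exact: sls_conjugate_ge.
by rewrite -lee_fin (le_trans (conjugate_ge0 a f0)).
Qed.

Lemma hgt0 : H 0%R = 0.
Proof.
apply/eqP; rewrite eq_le hgt_ge0 andbT; exact: hgt_le.
Qed.

End height_for_width.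

(** * Tangent lines of convex functions on the half-line *)

Lemma convex_tangent (R : realType) (g g' : R -> R) (x w : R) :
  (forall u v t : R, 0 <= u -> 0 <= v -> 0 <= t <= 1 ->
    g (t * u + (1 - t) * v) <= t * g u + (1 - t) * g v)%R ->
  derivative_on_nonneg g g' -> (0 <= x)%R -> (0 <= w)%R ->
  (g x + g' x * (w - x) <= g w)%R.
Proof.
move=> cg [dg dg0] x0 w0.
(* Convexity on the segment from [x] to [w]: dividing by [h] compares the difference quotient at [x]
   with the slope to [w], in a direction given by the sign of [h]. *)
have chord h : w != x -> (0 <= h / (w - x) <= 1)%R ->
    (g (h + x) - g x <= h / (w - x) * (g w - g x))%R.
  move=> wx h01; have := cg _ _ _ w0 x0 h01.
  have -> : (h / (w - x) * w + (1 - h / (w - x)) * x = h + x)%R.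
    by field; rewrite subr_eq0.
  lra.
have dgx : (0 < x)%R -> (h^-1 * (g (h + x) - g x))%R @[h --> (0%R : R)^'] --> g' x.
  move=> xp; have [dx <-] := dg _ xp; move: dx; rewrite /derivable /derive.
  by under eq_fun do rewrite /= /GRing.scale /= mulr1.
(* The right limit exists even at [x = 0]; the left one is needed only when [w < x], which forces
   [x > 0]. *)
have dgr : (h^-1 * (g (h + x) - g x))%R @[h --> (0%R : R)^'+] --> g' x.
  move: x0; rewrite le_eqVlt => /predU1P[<-|/dgx/cvg_dnbhs_at_right//].
  by under eq_fun do rewrite addr0.
have [wx|xw|->] := ltgtP w x; last by rewrite subrr mulr0 addr0.
- have wx0 : (w - x < 0)%R by rewrite subr_lt0.
  suff : ((g w - g x) / (w - x) <= g' x)%R by rewrite ler_ndivrMr//; lra.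
  have /dgx/cvg_dnbhs_at_left dgl : (0 < x)%R by lra.
  apply: (cvgr_to_ge dgl); near=> h.
  have h0 : (h < 0)%R by [].
  have hw : (w - x < h)%R by near: h; exact: nbhs_left_gt.
  have h01 : (0 <= h / (w - x) <= 1)%R.
    by rewrite ler_ndivlMr// ler_ndivrMr//; apply/andP; split; lra.
  have wxN : w != x by rewrite lt_eqF.
  rewrite ler_ndivlMl// mulrCA mulrC; have := chord h wxN h01; congr (_ <= _)%R; ring.
- have xw0 : (0 < w - x)%R by rewrite subr_gt0.
  suff : (g' x <= (g w - g x) / (w - x))%R by rewrite ler_pdivlMr//; lra.
  apply: (cvgr_to_le dgr); near=> h.
  have h0 : (0 < h)%R by [].
  have hw : (h < w - x)%R by near: h; exact: nbhs_right_lt.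
  have h01 : (0 <= h / (w - x) <= 1)%R.
    by rewrite ler_pdivlMr// ler_pdivrMr//; apply/andP; split; lra.
  have wxN : w != x by rewrite gt_eqF.
  rewrite ler_pdivrMl// mulrCA.
  have := chord h wxN h01; congr (_ <= _)%R; ring.
Unshelve. all: by end_near. Qed.

(** * Minimax duality for the height function *)

Section duality.
Context {R : realType}.
Variable phi : R -> \bar R.
Hypothesis phi_ge0 : forall x, 0 <= phi x.
Hypothesis phi_convex : ereal_convex phi.
Hypothesis phi_lsc : lower_semicontinuous phi.
Hypothesis phi1 : phi 1%R = 0.
Hypothesis phi_neg : forall x, (x < 0)%R -> phi x = +oo.
Implicit Types (a b c h m p r s t v w x y z : R).

Let psi := recentered phi.
Let psi_star := convex_conjugate psi.
Let H := hgt psi_star.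

Lemma recentered_ge0 x : 0 <= psi x. Proof. exact: phi_ge0. Qed.

Lemma recentered_convex : ereal_convex psi.
Proof.
move=> x y t t01; rewrite /psi /recentered.
have -> : (t * x + (1 - t) * y + 1 = t * (x + 1) + (1 - t) * (y + 1))%R by ring.
exact: phi_convex.
Qed.

Lemma recentered_lsc : lower_semicontinuous psi.
Proof.
move=> x m mx; have [e e0 He] := lower_semicontinuous_ball phi_lsc mx.
exists (ball x e); first exact: nbhsx_ballx.
move=> z xz; apply: He; rewrite opprD addrACA subrr addr0; exact: xz.
Qed.

Lemma recentered0 : psi 0%R = 0. Proof. by rewrite /psi /recentered add0r. Qed.

(** [psi] is infinite left of -1 and nonnegative elsewhere, and [x * y <= - y] for [x >= -1]. This
    makes the height function finite. *)
Lemma conjugate_neg_le y : (y <= 0)%R -> psi_star y <= (- y)%:E.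
Proof.
move=> y0; apply/conjugate_leP => x; have [x1|x1] := ltP x (-1)%R.
  by rewrite /psi /recentered phi_neg ?leey//; lra.
by apply: le_trans (recentered_ge0 x); rewrite lee_fin; nra.
Qed.

(** On the pair [- w], [0] the conjugate is at most [w]. *)
Lemma hgt_le_id w : (0 <= w)%R -> H w <= w%:E.
Proof.
move=> w0; rewrite -[w in H w]subr0 -[w in (w - 0)%R]opprK.
have -> : (- - w - 0 = 0 - (- w))%R by ring.
apply: hgt_pair_le; first exact: recentered0.
- by have := @conjugate_neg_le (- w)%R; rewrite opprK => -> //; lra.
- by apply: le_trans (conjugate_neg_le (lexx 0%R)) _; rewrite oppr0 lee_fin.
Qed.

Lemma hgt_fin_num w : (0 <= w)%R -> H w \is a fin_num.
Proof.
move=> w0; rewrite ge0_fin_numE; first by rewrite (le_lt_trans (hgt_le_id w0))// ltry.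
exact: hgt_ge0.
Qed.

Lemma conjugate_hgt_ge0 s : 0 <= conjugate_nonneg H s.
Proof.
apply: ereal_sup_ubound; exists 0%R; first exact: lexx.
by rewrite mulr0 /H hgt0 sube0.
Qed.

(** Both points lie in the sublevel set of height [Num.max h k], which thus bounds [H (b - a)]. This
    is the bound that [common_weight] converts into one with a single weight. *)
Lemma conjugate_hgt_pair s m a b h k : (0 <= s)%R -> conjugate_nonneg H s <= m%:E ->
  psi_star b <= h%:E -> psi_star a <= k%:E -> (s * (b - a) <= m + Num.max h k)%R.
Proof.
move=> s0 sm bh ak.
have m0 : (0 <= m)%R by rewrite -lee_fin (le_trans (conjugate_hgt_ge0 s)).
have bx : psi_star b <= (Num.max h k)%:E.
  by apply: le_trans bh _; rewrite lee_fin le_max lexx.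
have ax : psi_star a <= (Num.max h k)%:E.
  by apply: le_trans ak _; rewrite lee_fin le_max lexx orbT.
have x0 : (0 <= Num.max h k)%R.
  by rewrite -lee_fin (le_trans _ bx)// conjugate_ge0// recentered0.
have [ab|ba] := leP a b; last by nra.
have ba0 : (0 <= b - a)%R by rewrite subr_ge0.
have Hx : H (b - a)%R <= (Num.max h k)%:E by apply: hgt_pair_le => //; exact: recentered0.
have : (s * (b - a))%:E - H (b - a)%R <= m%:E.
  by apply: le_trans sm; apply: ereal_sup_ubound; exists (b - a)%R.
move: Hx; have := hgt_fin_num ba0; case: (H (b - a)%R) => [r| |] // _.
by rewrite -EFinB !lee_fin; lra.
Qed.

(** [m1] and [m2] bound the costs [p * phi (1 + s / p)] and [(1 - p) * phi (1 - s / (1 - p))] of the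
    two atoms; at [p = 0] the first becomes the cost of a singular mass [s]. [common_weight]
    supplies [p], and biconjugation turns bounds through [psi_star] into bounds on [phi]. *)
Lemma strong_duality s m : (0 < s)%R -> conjugate_nonneg H s <= m%:E ->
  exists p m1 m2, [/\ (0 <= p)%R, (p + s <= 1)%R, (m1 + m2 <= m)%R,
    phi (1 - s / (1 - p))%R <= (m2 / (1 - p))%:E &
    if p == 0%R then s%:E * recession_slope phi <= m1%:E
    else phi (1 + s / p)%R <= (m1 / p)%:E].
Proof.
move=> s0 sm.
pose P c h k := exists a b,
  [/\ psi_star b <= h%:E, psi_star a <= k%:E & c = (s * (b - a))%R].
have [||p /andP[p0 p1] Pp] := @common_weight R P m.
- move=> c h k c' h' k' t t01 [a [b [bh ak ->]]] [a' [b' [bh' ak' ->]]].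
  exists (t * a + (1 - t) * a')%R, (t * b + (1 - t) * b')%R.
  by split; [exact: conjugate_convex|exact: conjugate_convex|ring].
- by move=> _ h k [a [b [bh ak ->]]]; apply: conjugate_hgt_pair ak => //; exact: ltW.
have star0 : psi_star 0%R <= 0%:E.
  by have := conjugate_neg_le (lexx 0%R); rewrite oppr0.
(* For [p > 0], [sup S] is [p * psi (s / p)] written through the conjugate; it serves as [m1] and
   leaves [m - sup S] for the other atom. *)
pose S := [set x | exists b h, psi_star b <= h%:E /\ x = (s * b - p * h)%R].
have S0 : S 0%R by exists 0%R, 0%R; split => //; ring.
have Sub a k : psi_star a <= k%:E -> ubound S (m + s * a + (1 - p) * k)%R.
  move=> ak _ [b [h [bh ->]]].
  have : P (s * (b - a))%R h k by exists a, b.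
  by move/Pp; lra.
have Ssup : has_ubound S by eexists; apply: Sub star0.
have Sb b h : psi_star b <= h%:E -> (s * b - p * h <= sup S)%R.
  by move=> bh; apply: ub_le_sup => //; exists b, h.
have Sa a k : psi_star a <= k%:E -> (sup S <= m + s * a + (1 - p) * k)%R.
  by move=> ak; apply: ge_sup; [exists 0%R|exact: Sub].
have bic x z : (forall y h, psi_star y <= h%:E -> (x * y - h <= z)%R) -> psi x <= z%:E.
  apply: biconjugate_le; [exact: recentered_convex|exact: recentered_ge0|
    exact: recentered_lsc|exact: recentered0].
(* If [p = 1], the point [- ((m + 1) / s)] forces [sup S <= -1], yet 0 belongs to [S]. *)
have p1' : (p < 1)%R.
  rewrite lt_neqAle p1 andbT; apply/eqP => p1E.
  have S0' : (0 <= sup S)%R by exact: ub_le_sup.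
  have m0 : (0 <= m)%R by rewrite -lee_fin (le_trans (conjugate_hgt_ge0 s)).
  have ms0 : (- ((m + 1) / s) <= 0)%R by rewrite oppr_le0 divr_ge0//; lra.
  have := Sa _ _ (conjugate_neg_le ms0).
  rewrite p1E subrr mul0r addr0 mulrN mulrC divfK ?gt_eqF//; lra.
have q0 : (0 < 1 - p)%R by rewrite subr_gt0.
have m2 : psi (- (s / (1 - p)))%R <= ((m - sup S) / (1 - p))%:E.
  apply: bic => y h yh; rewrite ler_pdivlMr//.
  have -> : ((- (s / (1 - p)) * y - h) * (1 - p) = - (s * y) - (1 - p) * h)%R.
    by field; rewrite gt_eqF.
  by have := Sa _ _ yh; lra.
exists p, (sup S), (m - sup S)%R; split => //.
(* If [p + s > 1], the argument [1 - s / (1 - p)] is negative, where [phi] is infinite. *)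
- rewrite leNgt; apply/negP => ps; move: m2.
  rewrite /psi /recentered phi_neg//.
  have : (1 < s / (1 - p))%R by rewrite ltr_pdivlMr//; lra.
  lra.
- lra.
- by move: m2; rewrite /psi /recentered addrC.
case: eqP => [pE|/eqP pN0].
(* With [p = 0], every [y] where [psi_star] is finite satisfies [s * y <= sup S], so [psi] grows at
   most linearly with slope [sup S / s]. *)
- rewrite muleC -lee_pdivlMr// -EFinM; apply: recession_slope_le => // x x0.
  apply: bic => y h yh.
  have h0 : (0 <= h)%R.
    by rewrite -lee_fin (le_trans _ yh)// conjugate_ge0// recentered0.
  have := Sb _ _ yh; rewrite pE mul0r subr0 mulrC -ler_pdivlMr// => ys.
  have : (x * y <= x * (sup S / s))%R by rewrite ler_pM2l.
  lra.
- have pp : (0 < p)%R by rewrite lt_neqAle eq_sym pN0.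
  rewrite addrC; apply: bic => y h yh; rewrite ler_pdivlMr//.
  have -> : ((s / p * y - h) * p = s * y - p * h)%R by field.
  exact: Sb.
Qed.

(** Strict slack in height and in width replaces attainment. A negative [v], unavoidable when
    [w = 0], is served by the degenerate pair [0], [0]. *)
Lemma hgt_pair_near w h v : (0 <= w)%R -> (v < w)%R -> H w < h%:E ->
  exists a b, [/\ psi_star a <= h%:E, psi_star b <= h%:E & (v <= b - a)%R].
Proof.
move=> w0 vw wh; have [v0|v0] := ltP v 0%R.
  have star0 : psi_star 0%R <= h%:E.
    apply: le_trans (conjugate_neg_le (lexx 0%R)) _.
    by rewrite oppr0; apply: le_trans (ltW wh); exact: hgt_ge0.
  by exists 0%R, 0%R; split => //; rewrite subrr ltW.
have vw0 : (0 <= v < w)%R by rewrite v0.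
move/ereal_inf_lt: wh => [k [k0 wk] kh]; apply: sls_gt_pair vw0 _.
apply: le_trans wk _; apply: le_measure; rewrite ?inE.
- case: k k0 kh => [k| |] // _ _.
  by apply: is_interval_measurable; exact: sublevel_conjugate_itv.
- by apply: is_interval_measurable; exact: sublevel_conjugate_itv.
- by move=> x /= /le_trans; apply; exact: ltW.
Qed.

(** Convex combinations of the endpoints of two near-optimal intervals stay below the combined
    height, and the widths combine in the same way; [e] is the slack in height, [d] in width. *)
Lemma hgt_convex x y t : (0 <= x)%R -> (0 <= y)%R -> (0 <= t <= 1)%R ->
  (fine (H (t * x + (1 - t) * y)) <= t * fine (H x) + (1 - t) * fine (H y))%R.
Proof.
move=> x0 y0 t01; have /andP[t0 t1] := t01.
have z0 : (0 <= t * x + (1 - t) * y)%R.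
  by rewrite addr_ge0// mulr_ge0// subr_ge0.
have Hx := hgt_fin_num x0; have Hy := hgt_fin_num y0.
rewrite -lee_fin fineK ?hgt_fin_num//; apply/lee_addgt0Pr => e e0.
have Hxe : H x < (fine (H x) + e)%:E.
  by rewrite -[ltLHS]fineK// lte_fin ltrDl.
have Hye : H y < (fine (H y) + e)%:E.
  by rewrite -[ltLHS]fineK// lte_fin ltrDl.
rewrite -EFinD; apply: hgt_le.
  have := fine_ge0 (hgt_ge0 psi x); have := fine_ge0 (hgt_ge0 psi y).
  rewrite -/psi_star -/H => Hy0 Hx0.
  by apply: addr_ge0; [apply: addr_ge0; apply: mulr_ge0; lra|exact: ltW].
apply/lee_addgt0Pr => d d0.
have xd : (x - d < x)%R by rewrite gtrBl.
have yd : (y - d < y)%R by rewrite gtrBl.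
have [a [b [ax bx abx]]] := hgt_pair_near x0 xd Hxe.
have [a' [b' [ay by_ aby]]] := hgt_pair_near y0 yd Hye.
have az := conjugate_convex t01 ax ay; have bz := conjugate_convex t01 bx by_.
have hE : (t * (fine (H x) + e) + (1 - t) * (fine (H y) + e) =
  t * fine (H x) + (1 - t) * fine (H y) + e)%R by ring.
rewrite hE in az bz.
rewrite -leeBlDr//; apply: le_trans (sls_conjugate_ge az bz).
rewrite -EFinB lee_fin.
have : (t * (x - d) <= t * (b - a))%R by rewrite ler_wpM2l.
have : ((1 - t) * (y - d) <= (1 - t) * (b' - a'))%R by rewrite ler_wpM2l ?subr_ge0.
lra.
Qed.

(** The tangent at [x] lies below [H], so the supremum defining the conjugate is attained at
    [w = x]. *)
Lemma conjugate_hgt_derivative (H' : R -> R) x :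
  derivative_on_nonneg (fine \o H) H' -> (0 <= x)%R ->
  (0 <= H' x)%R /\ conjugate_nonneg H (H' x) = (x * H' x)%:E - H x.
Proof.
move=> dH x0.
have tangent w : (0 <= w)%R -> (fine (H x) + H' x * (w - x) <= fine (H w))%R.
  move=> w0; apply: (@convex_tangent _ (fine \o H) H') => //.
  by move=> u v t; exact: hgt_convex.
have fH0 w : (0 <= fine (H w))%R by apply: fine_ge0; exact: hgt_ge0.
have H0 : fine (H 0%R) = 0%R by rewrite /H hgt0.
split.
  (* For [x > 0], evaluate the tangent at 0, where [H] vanishes; for [x = 0], the right difference
     quotients are nonnegative. *)
  move: x0; rewrite le_eqVlt => /predU1P[x0|x0]; last first.
    by have := tangent 0%R (lexx _); have := fH0 x; rewrite H0 sub0r; nra.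
  case: dH => _; rewrite -x0 => /cvgr_to_ge; apply; near=> h.
  have h0 : (0 < h)%R by [].
  by rewrite /= H0 subr0 mulr_ge0 ?invr_ge0// ltW.
apply/eqP; rewrite eq_le; apply/andP; split; last first.
  by apply: ereal_sup_ubound; exists x => //; rewrite mulrC.
apply: ge_ereal_sup => _ [w /= w0 <-].
rewrite -[H w]fineK ?hgt_fin_num// -[H x]fineK ?hgt_fin_num//.
by rewrite -!EFinB lee_fin; have := tangent w w0; lra.
Unshelve. all: by end_near. Qed.

Lemma weak_duality_hgt s D : (0 <= s)%R -> (0 <= D)%R ->
  (forall a b h, (a <= b)%R -> psi_star a <= h%:E -> psi_star b <= h%:E ->
    (s * (b - a) <= D + h)%R) ->
  conjugate_nonneg H s <= D%:E.
Proof.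
move=> s0 D0 sD; apply: ge_ereal_sup => _ [w /= w0 <-].
have Hw := hgt_fin_num w0.
rewrite leeBlDr// -[H w]fineK// -EFinD.
apply/lee_addgt0Pr => e e0; rewrite -EFinD lee_fin.
have e2 : (0 < e / 2)%R by rewrite divr_gt0.
have Hwe : H w < (fine (H w) + e / 2)%:E by rewrite -[ltLHS]fineK// lte_fin ltrDl.
(* The width slack then costs [s * d <= e / 2], the other half of [e] being the height slack; the
   [+ 1] covers [s = 0]. *)
pose d := (e / 2 / (s + 1))%R.
have d0 : (0 < d)%R by rewrite divr_gt0//; lra.
have wd : (w - d < w)%R by rewrite gtrBl.
have [a [b [aw bw ab]]] := hgt_pair_near w0 wd Hwe.
have sd : (s * d <= e / 2)%R.
  have -> : (s * d = e / 2 * (s / (s + 1)))%R by rewrite /d; field; rewrite gt_eqF//; lra.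
  by rewrite ler_piMr ?(ltW e2)// ler_pdivrMr ?mul1r; lra.
have fH0 : (0 <= fine (H w))%R by apply: fine_ge0; exact: hgt_ge0.
have [ab0|ba0] := leP a b; last by nra.
have := sD _ _ _ ab0 aw bw.
have : (s * (w - d) <= s * (b - a))%R by rewrite ler_wpM2l.
lra.
Qed.

End duality.

(** * Lower bound on the divergence *)

Section decomposition.
Context d (T : measurableType d) (R : realType).
Implicit Types (mu nu : probability T R) (g : T -> R).

Lemma itv_bounded g (a b : R) : (forall x, a <= g x <= b)%R ->
  [bounded g x | x in [set: T]].
Proof.
move=> gab; exists (`|a| + `|b|)%R; split; first by rewrite num_real.
move=> y yab x _ /=; apply: ltW; apply: le_lt_trans yab.
have /andP[ag gb] := gab x; rewrite ler_norml; apply/andP; split.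
  by have := ler_norm (- a); rewrite normrN; have := normr_ge0 b; lra.
by have := ler_norm b; have := normr_ge0 a; lra.
Qed.

Lemma bounded_measurable_integrable (m : {finite_measure set T -> \bar R}) g (a b : R) :
  measurable_fun [set: T] g -> (forall x, a <= g x <= b)%R ->
  m.-integrable [set: T] (EFin \o g).
Proof.
move=> mg gab; apply: measurable_bounded_integrable => //.
  by rewrite ltey_eq fin_num_measure.
exact: itv_bounded gab.
Qed.

Lemma integral_cst_probability mu (c : R) : \int[mu]_x c%:E = c%:E.
Proof.
have muT : mu [set: T] = 1 by exact: probability_setT.
by rewrite integral_cst// [X in _ * X]muT mule1.
Qed.

Lemma lebesgue_decompositionP mu nu :
  is_lebesgue_decomposition mu nu (ac_part mu nu, singular_part mu nu).
Proof.
by rewrite /ac_part /singular_part -surjective_pairing /lebesgue_decomposition;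
  case: cid.
Qed.

Lemma integral_decomposition mu nu g (a b : R) :
  measurable_fun [set: T] g -> (forall x, a <= g x <= b)%R ->
  \int[mu]_x (g x)%:E =
    \int[ac_part mu nu]_x (g x)%:E + \int[singular_part mu nu]_x (g x)%:E.
Proof.
move=> mg gab; have [muE _ _] := lebesgue_decompositionP mu nu.
rewrite -integral_measure_add//; [|exact: bounded_measurable_integrable gab..].
apply: (eq_measure_integral (measure_add _ _)) => A mA _.
rewrite (muE A mA) -[RHS]/(measure_add (ac_part mu nu) (singular_part mu nu) A).
by rewrite measure_addE.
Qed.

End decomposition.

(** Adds the bounds on the absolutely continuous and singular parts; only [K], the singular term,
    may be infinite. *)
Lemma lee_combine (R : realType) (A B N I K : \bar R) (h : R) :
  A \is a fin_num -> B \is a fin_num -> N \is a fin_num -> I \is a fin_num ->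
  0 <= K -> A - N - h%:E <= I -> B <= K -> A + B - N <= I + K + h%:E.
Proof.
case: A B N I K => [A| |] [B| |] [N| |] [I| |] [K| |] // _ _ _ _ _.
  by rewrite -!EFinB -!EFinD !lee_fin; lra.
by move=> _ _; exact: leey.
Qed.

Section weak_duality.
Local Open Scope charge_scope.
Context d (T : measurableType d) (R : realType).
Variable phi : R -> \bar R.
Hypothesis phi_ge0 : forall x, 0 <= phi x.
Hypothesis phi_convex : ereal_convex phi.
Hypothesis phi_lsc : lower_semicontinuous phi.
Hypothesis phi1 : phi 1%R = 0.
Implicit Types (mu nu : probability T R) (g : T -> R).

Let psi_star := convex_conjugate (recentered phi).

Lemma recession_slope_phi_ge0 : 0 <= recession_slope phi.
Proof. by rewrite recession_slopeE// recession_slope_ge0. Qed.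

Lemma phi_divergence_ge0 mu nu : 0 <= phi_divergence phi mu nu.
Proof.
apply: adde_ge0; first by apply: integral_ge0 => x _; exact: phi_ge0.
by apply: mule_ge0 => //; exact: recession_slope_phi_ge0.
Qed.

Lemma measurable_phi_derivative mu nu : measurable_fun [set: T]
  (fun x => phi (fine ('d (charge_of_finite_measure (ac_part mu nu)) '/d nu x))).
Proof.
have [_ ac _] := lebesgue_decompositionP mu nu.
apply: (measurableT_comp (lower_semicontinuous_measurable phi_lsc)).
exact: (measurableT_comp (fine_measurable _)).
Qed.

(* Fenchel-Young, integrated *)
Lemma phi_divergence_ge_integral mu nu g (a b h : R) :
  psi_star a <= h%:E -> psi_star b <= h%:E ->
  measurable_fun [set: T] g -> (forall x, a <= g x <= b)%R ->
  \int[mu]_x (g x)%:E - \int[nu]_x (g x)%:E <= phi_divergence phi mu nu + h%:E.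
Proof.
move=> ah bh mg gab; have [_ ac _] := lebesgue_decompositionP mu nu.
rewrite (integral_decomposition mu nu mg gab) /phi_divergence.
set f := 'd _ '/d _; set I := \int[nu]_x phi _.
set c := ac_part mu nu in ac f I *; set s := singular_part mu nu.
have intg (m : {finite_measure set T -> \bar R}) : m.-integrable [set: T] (EFin \o g).
  exact: bounded_measurable_integrable gab.
have fing (m : {finite_measure set T -> \bar R}) : \int[m]_x (g x)%:E \is a fin_num.
  by apply: integrable_fin_num => //; exact: intg.
(* On the singular part, [g <= b] and [b] is at most the recession slope. *)
have sg : \int[s]_x (g x)%:E <= s [set: T] * recession_slope phi.
  apply: (@le_trans _ _ (b%:E * s [set: T])).
    rewrite -integral_cst//; apply: le_integral => //.
    - exact: intg.
    - exact: finite_measure_integrable_cst.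
    - by move=> x _; rewrite lee_fin; have /andP[] := gab x.
  rewrite muleC; apply: lee_wpmul2l => //.
  exact: conjugate_dom_le_recession_slope bh.
have I0 : 0 <= I by apply: integral_ge0 => x _; exact: phi_ge0.
have [Iy|Iy] := eqVneq I +oo.
  rewrite Iy addye; last first.
    rewrite gt_eqF// (lt_le_trans (ltNyr 0%R))// mule_ge0//.
    exact: recession_slope_phi_ge0.
  by rewrite addye// leey.
have fE x : f x = (fine (f x))%:E by rewrite fineK// Radon_Nikodym_fin_num.
have intf : nu.-integrable [set: T] f by exact: Radon_Nikodym_integrable.
have bg : [bounded g x | x in [set: T]] by exact: itv_bounded gab.
have intgf : nu.-integrable [set: T] (fun x => (g x)%:E * f x).
  exact: integrableMr.
have cI : \int[c]_x (g x)%:E - \int[nu]_x (g x)%:E - h%:E <= I.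
  rewrite -(Radon_Nikodym_change_of_variables ac measurableT (intg c)).
  rewrite -[h%:E](integral_cst_probability nu).
  rewrite -integralB//; last exact: intg.
  have inth : nu.-integrable [set: T] (fun=> h%:E).
    exact: finite_measure_integrable_cst.
  rewrite -integralB//; last by apply: integrableB => //; exact: intg.
  apply: le_integral => //.
  - by apply: integrableB => //; apply: integrableB => //; exact: intg.
  - apply/integrableP; split; first exact: measurable_phi_derivative.
    under eq_integral do rewrite gee0_abs ?phi_ge0//.
    by rewrite ltey.
  move=> x _; rewrite -/f fE -EFinM -!EFinB.
  (* [g x] lies between [a] and [b], hence in the sublevel interval; Fenchel-Young is applied at the
     density shifted by 1. *)
  have /conjugate_leP/(_ (fine (f x) - 1)%R) := sublevel_conjugate_itv ah bh (gab x).
  by rewrite /recentered subrK; apply: le_trans; rewrite lee_fin; lra.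
have Ifin : I \is a fin_num by rewrite ge0_fin_numE// ltey.
apply: lee_combine cI sg => //.
by rewrite mule_ge0// recession_slope_phi_ge0.
Qed.

Lemma integral_affine mu g (a b : R) : measurable_fun [set: T] g ->
  (forall x, -1 <= g x <= 1)%R ->
  \int[mu]_x (a + b * g x)%:E = a%:E + b%:E * \int[mu]_x (g x)%:E.
Proof.
move=> mg g1; have intg : mu.-integrable [set: T] (EFin \o g).
  exact: bounded_measurable_integrable g1.
under eq_integral do rewrite EFinD EFinM.
rewrite integralD//; last exact: integrableZl.
  by rewrite integral_cst_probability integralZl.
exact: finite_measure_integrable_cst.
Qed.

Lemma phi_divergence_ge_TV mu nu (e a b h D : R) : TV mu nu = e%:E ->
  phi_divergence phi mu nu = D%:E -> (a <= b)%R ->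
  psi_star a <= h%:E -> psi_star b <= h%:E -> (e / 2 * (b - a) <= D + h)%R.
Proof.
move=> TVe DE ab ah bh.
have gP g : measurable_fun [set: T] g -> (forall x, -1 <= g x <= 1)%R ->
    ((b - a) / 2 * (fine (\int[mu]_x (g x)%:E) - fine (\int[nu]_x (g x)%:E)) <= D + h)%R.
  move=> mg g1.
  have fing (m : probability T R) : \int[m]_x (g x)%:E \is a fin_num.
    by apply: integrable_fin_num => //; exact: bounded_measurable_integrable g1.
  (* The affine map from [[-1, 1]] onto [[a, b]]; its slope produces the factor [(b - a) / 2]. *)
  pose G x := ((a + b) / 2 + (b - a) / 2 * g x)%R.
  have mG : measurable_fun [set: T] G.
    by apply: measurable_funD => //; exact: measurable_funM.
  have Gab x : (a <= G x <= b)%R.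
    by have /andP[? ?] := g1 x; apply/andP; split; rewrite /G; nra.
  have := phi_divergence_ge_integral mu nu ah bh mG Gab.
  rewrite DE !integral_affine// -(fineK (fing mu)) -(fineK (fing nu)).
  rewrite -!EFinM -!EFinD lee_fin /=; lra.
have h0 : (0 <= h)%R.
  by rewrite -lee_fin (le_trans _ ah)// conjugate_ge0// /recentered add0r.
have D0 : (0 <= D)%R by rewrite -lee_fin -DE phi_divergence_ge0.
have [->|ba] := eqVneq b a; first by rewrite subrr mulr0 addr_ge0.
have ba0 : (0 < b - a)%R by rewrite subr_gt0 lt_neqAle eq_sym ba.
suff : TV mu nu <= (2 * (D + h) / (b - a))%:E.
  by rewrite TVe lee_fin ler_pdivlMr//; lra.
apply: ge_ereal_sup => _ [g /= [mg g1] <-].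
have fing (m : probability T R) : \int[m]_x (g x)%:E \is a fin_num.
  by apply: integrable_fin_num => //; exact: bounded_measurable_integrable g1.
(* Testing [- g] as well handles the absolute value in [TV]; it is written in the form expected by
   [integral_affine]. *)
have ng1 x : (-1 <= 0 + -1 * g x <= 1)%R.
  by have /andP[? ?] := g1 x; apply/andP; split; lra.
have mng : measurable_fun [set: T] (fun x => 0 + -1 * g x)%R.
  by apply: measurable_funD => //; exact: measurable_funM.
have := gP _ mg g1; have := gP _ mng ng1.
rewrite !integral_affine// -(fineK (fing mu)) -(fineK (fing nu)).
rewrite -!EFinM -!EFinD /= lee_fin => H1 H2.
rewrite ler_pdivlMr//; set u := fine _ in H1 H2 *; set v := fine _ in H1 H2 *.
have [uv|uv] := ler0P (u - v)%R; lra.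
Qed.

End weak_duality.

(** * Two-point measures *)

Section two_points.
Local Open Scope charge_scope.
Context d (T : measurableType d) (R : realType).
Implicit Types (p s : R) (a b : T).

Lemma two_point_probability p a b : (0 <= p <= 1)%R -> exists P : probability T R,
  (forall A, P A = p%:E * \d_a A + (1 - p)%:E * \d_b A) /\
  (forall f, measurable_fun [set: T] f -> (forall x, 0 <= f x) ->
    \int[P]_x f x = p%:E * f a + (1 - p)%:E * f b).
Proof.
move=> /andP[p0 p1]; have q0 : (0 <= 1 - p)%R by rewrite subr_ge0.
pose ma : {measure set T -> \bar R} := mscale (NngNum p0) \d_a.
pose mb : {measure set T -> \bar R} := mscale (NngNum q0) \d_b.
pose mab n : {measure set T -> \bar R} := if n is 0%N then ma else mb.
have mE A : msum mab 2 A = p%:E * \d_a A + (1 - p)%:E * \d_b A.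
  exact: (measure_addE ma mb).
have mT : msum mab 2 [set: T] = 1.
  by rewrite mE !diracT !mule1 -EFinD addrC subrK.
pose P : probability T R :=
  HB.pack (msum mab 2) (@Measure_isProbability.Build _ T R (msum mab 2) mT).
exists P; split => //= f mf f0.
rewrite (ge0_integral_measure_add ma mb)//.
by rewrite !ge0_integral_mscale//= !integral_dirac// !diracT !mul1e.
Qed.

(** The formula for nonnegative functions is applied to the positive and negative parts of [f]. *)
Lemma integral_two_point p a b (P : probability T R) (f : T -> R) : (0 <= p <= 1)%R ->
  (forall g, measurable_fun [set: T] g -> (forall x, 0 <= g x) ->
    \int[P]_x g x = p%:E * g a + (1 - p)%:E * g b) ->
  measurable_fun [set: T] f ->
  \int[P]_x (f x)%:E = (p * f a + (1 - p) * f b)%:E.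
Proof.
move=> p01 PE mf.
have mf' : measurable_fun [set: T] (EFin \o f) by exact/measurable_EFinP.
rewrite integralE !PE//; last 2 first.
- exact: measurable_funeneg.
- exact: measurable_funepos.
rewrite !funeposE !funenegE /= -!EFin_max -!EFinM -!EFinD; congr (_%:E).
have maxB (x : R) : (Num.max x 0 = x + Num.max (- x) 0)%R.
  by have [x0|x0] := leP x 0%R; [rewrite max_l|rewrite max_r]; lra.
rewrite (maxB (f a)) (maxB (f b)); ring.
Qed.

Variable phi : R -> \bar R.
Hypothesis phi_ge0 : forall x, 0 <= phi x.
Hypothesis phi_convex : ereal_convex phi.
Hypothesis phi_lsc : lower_semicontinuous phi.
Hypothesis phi1 : phi 1%R = 0.

(** [nu] and [mu] put masses [p] and [p + s] on [a], the rest on [b]. Singletons need not be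
    measurable, so the decomposition of [mu] is read off from null sets and from integrals, with [A]
    separating the points. *)
Lemma two_point_divergence_le (A : set T) a b p s (m1 m2 : R) :
  measurable A -> A a -> ~ A b -> (0 <= s)%R -> (0 <= p < 1)%R -> (p + s <= 1)%R ->
  phi (1 - s / (1 - p))%R <= (m2 / (1 - p))%:E ->
  (if p == 0%R then s%:E * recession_slope phi <= m1%:E
    else phi (1 + s / p)%R <= (m1 / p)%:E) ->
  divergence_at_TV T phi (2 * s)%R <= (m1 + m2)%:E.
Proof.
move=> mA Aa Ab s0 /andP[p0 p1] ps Hm2 Hm1.
have p01 : (0 <= p <= 1)%R by rewrite p0 ltW.
have q01 : (0 <= p + s <= 1)%R by rewrite addr_ge0.
have q0 : (0 < 1 - p)%R by rewrite subr_gt0.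
have [nu [nuA nuE]] := two_point_probability a b p01.
have [mu [muA muE]] := two_point_probability a b q01.
have mAC : measurable (~` A) by exact: measurableC.
have muAE : mu A = (p + s)%:E.
  by rewrite muA !diracE mem_set// memNset// mule1 mule0 adde0.
have muACE : mu (~` A) = (1 - (p + s))%:E.
  rewrite muA !diracE (memNset (_ : ~ (~` A) a)); last by apply.
  by rewrite mem_set// mule1 mule0 add0e.
apply: ge_ereal_inf; exists (phi_divergence phi mu nu).
  exists mu, nu; split => //.
  have TVg (g : T -> R) : measurable_fun [set: T] g ->
      `| \int[mu]_x (g x)%:E - \int[nu]_x (g x)%:E | = (s * `|g a - g b|)%:E.
    move=> mg; rewrite (integral_two_point q01 muE mg) (integral_two_point p01 nuE mg).
    rewrite -EFinB abse_EFin; congr (_%:E).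
    by rewrite -[s in RHS]ger0_norm// -normrM; congr (`|_|)%R; ring.
  apply/eqP; rewrite eq_le; apply/andP; split.
    apply: ge_ereal_sup => _ [g [mg g1] <-]; rewrite TVg// lee_fin mulrC.
    apply: ler_wpM2r => //; rewrite ler_norml.
    by have /andP[? ?] := g1 a; have /andP[? ?] := g1 b; apply/andP; split; lra.
  apply: ereal_sup_ubound.
  (* The sign function of [A] attains the largest possible gap 2 between [g a] and [g b]. *)
  pose g x : R := (2 * \1_A x - 1)%R.
  have mg : measurable_fun [set: T] g.
    by apply: measurable_funB => //; apply: measurable_funM => //;
      exact: measurable_indic.
  exists g; last first.
    rewrite TVg// /g !indicE mem_set// memNset//= mulr1 mulr0.
    have -> : (2 - 1 - (0 - 1) = 2 :> R)%R by ring.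
    by rewrite ger0_norm// mulrC.
  split => // x; rewrite /g indicE.
  by case: (_ \in _) => /=; apply/andP; split; lra.
have [muD' ac [B [mB sB nuB']]] := lebesgue_decompositionP mu nu.
have nuB : nu (~` B) = 0 := nuB'.
have muD C (mC : measurable C) :
  mu C = ac_part mu nu C + singular_part mu nu C := muD' C mC.
rewrite /phi_divergence; set f := 'd _ '/d _.
set c := ac_part mu nu in ac f muD *; set t := singular_part mu nu in muD sB *.
have tB : t B = 0 := sB.
(* [nu] vanishes off [B], while any measurable set containing [b] has mass at least [1 - p > 0]. *)
have Bb : B b.
  apply: contrapT => nBb; move: nuB; rewrite nuA !diracE (mem_set (nBb : (~` B) b)) mule1.
  move/eqP; rewrite padde_eq0 ?mule_ge0 ?lee_fin ?ler0n// ?(ltW q0)//.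
  by move=> /andP[_]; rewrite eqe gt_eqF.
(* [t] vanishes on [B], and outside [B] it is at most [mu]. *)
have tle C : measurable C -> mu (C `\` B) = 0 -> t C = 0.
  move=> mC muC; have mCB : measurable (C `\` B) by exact: measurableD.
  apply/eqP; rewrite -measure_le0; apply: (@le_trans _ _ (t (B `|` (C `\` B)))).
    apply: le_measure; rewrite ?inE//; first exact: measurableU.
    by move=> x Cx; have [Bx|Bx] := pselect (B x); [left|right].
  apply: (@le_trans _ _ (t B + t (C `\` B))); first exact: measureU2.
  by rewrite tB add0e -muC (muD _ mCB) leeDr.
have tAC : t (~` A) = 0.
  apply: tle => //; rewrite muA !diracE memNset; last by case => /(_ Aa).
  by rewrite memNset ?mule0 ?adde0//; case.
have mf : measurable_fun [set: T] (fun x => fine (f x)).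
  apply: (measurableT_comp (fine_measurable _)) => //.
  by apply: measurable_int; exact: Radon_Nikodym_integrable.
have cE C : measurable C ->
    c C = (p * (fine (f a) * \1_C a) + (1 - p) * (fine (f b) * \1_C b))%:E.
  move=> mC; rewrite -[LHS]/(charge_of_finite_measure c C).
  rewrite (@Radon_Nikodym_integral _ _ _ (charge_of_finite_measure c) nu C ac mC).
  rewrite integral_mkcond.
  rewrite -(integral_two_point (f := fun x => (fine (f x) * \1_C x)%R) p01 nuE).
    apply: eq_integral => x _; rewrite patchE indicE.
    case: ifP => xC; last by rewrite mulr0.
    by rewrite mulr1 fineK// Radon_Nikodym_fin_num.
  by apply: measurable_funM => //; exact: measurable_indic.
have fb : fine (f b) = (1 - s / (1 - p))%R.
  have := muD _ mAC; rewrite muACE tAC adde0 cE// !indicE.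
  rewrite (memNset (_ : ~ (~` A) a)); last by apply.
  rewrite mem_set//= mulr0 mulr0 add0r mulr1 => -[H].
  apply: (mulfI (lt0r_neq0 q0)); rewrite -H; field; exact: lt0r_neq0.
have fa : (p * fine (f a))%:E = c A.
  by rewrite cE// !indicE mem_set// memNset//= !mulr0 addr0 mulr1.
have tT : t [set: T] = t A.
  rewrite -(setUv A) measureU//; last by rewrite setICr.
  by rewrite -[X in _ + X]/(t (~` A)) tAC adde0.
rewrite tT nuE; last 2 first.
- exact: measurable_phi_derivative.
- by move=> x; exact: phi_ge0.
rewrite -/f fb.
have D2 : (1 - p)%:E * phi (1 - s / (1 - p))%R <= m2%:E.
  by rewrite muleC -lee_pdivlMr// -EFinM.
case: eqP Hm1 => [pE|/eqP pN0] Hm1.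
  (* With [p = 0], [nu] does not charge [A], so the whole mass [s] that [mu] gives to [A] is
     singular. *)
  have cA : c A = 0 by rewrite -fa pE mul0r.
  have -> : t A = s%:E by have := muD _ mA; rewrite cA add0e muAE pE add0r => <-.
  by rewrite {1}pE mul0e add0e [leRHS]EFinD addeC leeD.
have pp : (0 < p)%R by rewrite lt_neqAle eq_sym pN0.
(* With [p > 0], both points lie in [B]; the singular part vanishes and the density at [a] is the
   ratio of masses. *)
have Ba : B a.
  apply: contrapT => nBa; move: nuB; rewrite nuA !diracE (mem_set (nBa : (~` B) a)) mule1.
  move/eqP; rewrite padde_eq0 ?mule_ge0 ?lee_fin ?ler0n// ?(ltW q0)//.
  by move=> /andP[]; rewrite eqe gt_eqF.
have tA : t A = 0.
  apply: tle => //; rewrite muA !diracE memNset; last by case.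
  by rewrite memNset ?mule0 ?adde0//; case.
rewrite tA mul0e adde0.
have -> : fine (f a) = (1 + s / p)%R.
  have := muD _ mA; rewrite tA adde0 -fa muAE => -[H].
  apply: (mulfI (lt0r_neq0 pp)); rewrite -H; field; exact: lt0r_neq0.
by rewrite [leRHS]EFinD leeD// muleC -lee_pdivlMr// -EFinM.
Qed.

End two_points.

(** * Separated points and equality of the two bounds *)

Lemma measurable_set_nontrivial d (T : measurableType d) :
  [set set0; [set: T]] `<` [set A : set T | measurable A] ->
  exists (A : set T) (a b : T), [/\ measurable A, A a & ~ A b].
Proof.
move=> [_ /nonsubset[A [mA /not_orP[A0 AT]]]].
have [a Aa] : A !=set0 by apply/set0P/eqP.
have [b Ab] : ~` A !=set0.
  by apply/set0P/eqP => AC0; apply: AT; rewrite -[A]setCK AC0 setC0.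
by exists A, a, b.
Qed.

Theorem corollary6p3p7
  (R : realType) (d : measure_display) (Omega : measurableType d)
  (Omega_nontrivial :
    [set set0; [set: Omega]] `<` [set A : set Omega | measurable A])
  (phi : R -> \bar R)
  (phi_ge0 : forall x, 0 <= phi x)
  (phi_convex : ereal_convex phi)
  (phi_lsc : lower_semicontinuous phi)
  (phi1 : phi 1%R = 0)
  (phi_neg : forall x, (x < 0)%R -> phi x = +oo)
  (phi_dom1 : nbhs (1%R : R) (dom phi)) :
  let H := hgt (convex_conjugate (recentered phi)) in
  (forall e : R, (0 <= e)%R ->
     divergence_at_TV Omega phi e = conjugate_nonneg H (e / 2)%R) /\
  (forall H' : R -> R, derivative_on_nonneg (fine \o H) H' ->
     forall x : R, (0 <= x)%R ->
       divergence_at_TV Omega phi (2 * H' x)%R = (x * H' x)%:E - H x).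
Proof.
move=> H; have [A [a [b [mA Aa Ab]]]] := measurable_set_nontrivial Omega_nontrivial.
have V e : (0 <= e)%R -> divergence_at_TV Omega phi e = conjugate_nonneg H (e / 2)%R.
  move=> e0; have s0 : (0 <= e / 2)%R by rewrite divr_ge0.
  apply/eqP; rewrite eq_le; apply/andP; split.
    have := conjugate_hgt_ge0 phi (e / 2)%R; rewrite -/H.
    case E : (conjugate_nonneg H (e / 2)%R) => [m| |] // m0; last exact: leey.
    have -> : e = (2 * (e / 2))%R by rewrite mulrC divfK.
    (* [strong_duality] divides by [s] and covers only [s > 0]; for [s = 0], equal measures with
       mass one half at each point have cost 0. *)
    have [se0|sN0] := eqVneq (e / 2)%R 0%R.
      apply: (@le_trans _ _ (0 + 0)%:E); last by rewrite addr0.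
      apply: (two_point_divergence_le (p := 2^-1) phi_ge0 phi_lsc mA Aa Ab) => //;
        rewrite ?se0 ?mul0r ?subr0 ?addr0 ?phi1 ?mul0r//.
      - by apply/andP; split; lra.
      - lra.
      - by rewrite gt_eqF ?invr_gt0// ?mul0r ?addr0 ?phi1.
    have sp : (0 < e / 2)%R by rewrite lt_neqAle eq_sym sN0.
    have Em : conjugate_nonneg H (e / 2)%R <= m%:E by rewrite E.
    have [p [m1 [m2 [p0 ps m12 H2 H1]]]] :=
      strong_duality phi_ge0 phi_convex phi_lsc phi1 phi_neg sp Em.
    apply: (@le_trans _ _ (m1 + m2)%:E); last by rewrite lee_fin.
    have p01 : (0 <= p < 1)%R by apply/andP; split; lra.
    exact: (two_point_divergence_le phi_ge0 phi_lsc mA Aa Ab s0 p01 ps).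
  apply: le_ereal_inf_tmp => _ [mu [nu [TVe ->]]].
  have := phi_divergence_ge0 phi_ge0 phi_convex phi1 mu nu.
  case DE : (phi_divergence phi mu nu) => [D| |] // D0; last exact: leey.
  apply: weak_duality_hgt => // x y h xy hx hy.
  exact: (phi_divergence_ge_TV phi_ge0 phi_convex phi_lsc phi1 TVe DE xy hx hy).
split=> // H' dH x x0.
have [H'0 <-] := conjugate_hgt_derivative phi_ge0 phi1 phi_neg dH x0.
by rewrite V ?mulr_ge0// mulrAC divff ?mul1r.
Qed.
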